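(* Let $k\ge1$, let $\varepsilon_1,\dots,\varepsilon_k>0$, and let $\mathcal{M}_i$ be the class of $\varepsilon_i$-bounded-range mechanisms, $i=1,\dots,k$. Then for every $\delta_g\in[0,1]$, $(\mathcal{M}_1,\dots,\mathcal{M}_k)$ is $(\varepsilon_g(\delta_g),\delta_g)$-DP under $k$-fold adaptive composition, where $$\varepsilon_g(\delta)=\min\left\{\sum_{i=1}^k\varepsilon_i,\ \ \sum_{i=1}^k\left(\frac{\varepsilon_i}{1-e^{-\varepsilon_i}}-1-\ln\left(\frac{\varepsilon_i}{1-e^{-\varepsilon_i}}\right)\right)+\sqrt{\frac12\sum_{i=1}^k\varepsilon_i^2\,\ln(1/\delta)}\right\},$$ the second entry of the minimum being read as $+\infty$ when $\delta=0$.
   Context: A data universe is a set $\mathcal{X}$ with a symmetric neighboring relation $x\sim x'$. A mechanism $M:\mathcal{X}\to\mathcal{Y}$ assigns to each $x$ a probability distribution of a random outcome $M(x)\in\mathcal{Y}$; $\Pr[M(x)=y]$ denotes the probability mass function, or, for continuous outcome spaces, the probability density function with respect to a common reference measure. $M$ is $\varepsilon$-bounded-range if for all neighbors $x\sim x'$ and all $y_1,y_2\in\mathcal{Y}$, $\frac{\Pr[M(x)=y_1]}{\Pr[M(x')=y_1]}\le e^{\varepsilon}\frac{\Pr[M(x)=y_2]}{\Pr[M(x')=y_2]}$ (in cross-multiplied form when probabilities vanish). Adaptive composition game: an adversary is a pair $\mathcal{A}=(\mathcal{R},\mathcal{D})$ with $\mathcal{R}$ a randomized algorithm and $\mathcal{D}$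 a deterministic one. Given classes of mechanisms $\vec{\mathcal{E}}=(\mathcal{E}_1,\dots,\mathcal{E}_k)$ and a bit $b\in\{0,1\}$, the game $\mathrm{AdaComp}(\mathcal{A},\vec{\mathcal{E}},b)$ runs: draw $r_0\sim\mathcal{R}(\emptyset)$; for $i=1,\dots,k$: $\mathcal{D}(r_0,A_1^b,r_1,\dots,A_{i-1}^b,r_{i-1})$ selects neighboring datasets $x^{i,0}\sim x^{i,1}$ and a mechanism $M_i\in\mathcal{E}_i$, the outcome $A_i^b=M_i(x^{i,b})$ is drawn with fresh randomness, and $r_i\sim\mathcal{R}(r_0,A_1^b,\dots,r_{i-1},A_i^b)$. The output is the view $(r_0,A_1^b,r_1,\dots,A_k^b,r_k)$. $\vec{\mathcal{E}}$ is $(\varepsilon_g,\delta_g)$-DP under $k$-fold adaptive composition if for every adversary $\mathcal{A}$, every $b\in\{0,1\}$ and every (measurable) set $S$ of outputs, $\Pr[\mathrm{AdaComp}(\mathcal{A},\vec{\mathcal{E}},b)\in S]\le e^{\varepsilon_g}\Pr[\mathrm{AdaComp}(\mathcal{A},\vec{\mathcal{E}},1-b)\in S]+\delta_g$. *)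

(* Defs.v *)
From HB Require Import structures.
From mathcomp Require Import all_boot all_order all_algebra.
From mathcomp Require Import all_classical all_reals all_analysis.
From mathcomp Require Import measurable_realfun.

Set Implicit Arguments.
Unset Strict Implicit.
Unset Printing Implicit Defensive.
Import Order.TTheory GRing.Theory Num.Theory.
Import numFieldNormedType.Exports.

Local Open Scope classical_set_scope.
Local Open Scope ring_scope.

Definition mechanism (R : realType) (X : Type) d (Y : measurableType d) :=
  X -> probability Y R.

(* [p x] is the density of [M x] with respect to [mu]; the case of probability
   mass functions is the one where [mu] is a counting measure. *)
Definition has_density (R : realType) (X : Type) d (Y : measurableType d)
    (M : mechanism R X Y) (mu : {measure set Y -> \bar R}) (p : X -> Y -> R) :=
  forall x, [/\ measurable_fun [set: Y] (p x),
    forall y, 0 <= p x y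
    & forall A, measurable A -> M x A = (\int[mu]_(y in A) (p x y)%:E)%E].

(* The cross-multiplied form of
   p x y1 / p x' y1 <= e^eps * (p x y2 / p x' y2). *)
Definition bounded_range (R : realType) (X : Type) (sim : X -> X -> Prop)
    d (Y : measurableType d) (eps : R) : set (mechanism R X Y) :=
  [set M | exists (mu : {measure set Y -> \bar R}) (p : X -> Y -> R),
    has_density M mu p /\
    forall x x', sim x x' -> forall y1 y2,
      p x y1 * p x' y2 <= expR eps * (p x y2 * p x' y1)].
Arguments bounded_range {R X} sim {d} Y eps.

Section semidirect_product.
Local Open Scope ereal_scope.
Context (R : realType) d d' (H : measurableType d) (Z : measurableType d').
Variables (mu : probability H R) (K : R.-pker H ~> Z).

(* Joint law of (h, z) when h is drawn from mu and then z from K h. *)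
Definition semidirect (S : set (H * Z)) : \bar R :=
  \int[mu]_h K h (xsection S h).

Let measurable_semidirect S : measurable S ->
  measurable_fun [set: H] (fun h => K h (xsection S h)).
Proof. by move=> mS; by apply: measurable_fun_xsection_finite_kernel; rewrite inE. Qed.

Let semidirect0 : semidirect set0 = 0.
Proof. by apply: integral0_eq => h _; rewrite xsection0 measure0. Qed.

Let semidirect_ge0 S : 0 <= semidirect S.
Proof. exact: integral_ge0. Qed.

Let semidirect_sigma_additive : semi_sigma_additive semidirect.
Proof.
move=> F mF tF mUF.
rewrite (_ : semidirect (\bigcup_n F n) =
    \sum_(n <oo) semidirect (F n)); last first.
  rewrite -integral_nneseries//; last by move=> n; exact: measurable_semidirect.
  apply: eq_integral => h _; rewrite xsection_bigcup.
  rewrite measure_semi_bigcup//.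
  - by move=> n; exact: measurable_xsection.
  - exact: trivIset_xsection.
  - by apply: bigcupT_measurable => n; exact: measurable_xsection.
by apply: is_cvg_nneseries => n _ _; exact: semidirect_ge0.
Qed.

HB.instance Definition _ := isMeasure.Build _ _ _ semidirect
  semidirect0 semidirect_ge0 semidirect_sigma_additive.

Let semidirect_setT : semidirect [set: H * Z] = 1.
Proof.
rewrite /semidirect (eq_integral (cst 1)).
  by rewrite integral_cst// mul1e; exact: (@probability_setT _ _ _ mu).
move=> h _; rewrite (_ : xsection _ h = [set: Z]) ?prob_kernel//.
by rewrite -setXTT in_xsectionX// inE.
Qed.

HB.instance Definition _ :=
  Measure_isProbability.Build _ _ _ semidirect semidirect_setT.

End semidirect_product.

Section adaptive_composition.
Context (R : realType) (X : Type) (sim : X -> X -> Prop).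
(* Y i is the outcome space of round i (rounds are numbered from 0), and T is
   the output space of the randomized algorithm of the adversary. Mechanisms of
   the same round with different outcome spaces are covered by taking the
   disjoint union of these spaces as Y i. *)
Context (dY : nat -> measure_display) (Y : forall i, measurableType (dY i)).

Section game.
Context (dT : measure_display) (T : measurableType dT).

Fixpoint view_display (i : nat) : measure_display :=
  if i is j.+1 then ((view_display j, dY j).-prod, dT).-prod%mdisp else dT.

(* Views (r_0, A_1, r_1, ..., A_i, r_i) after i rounds, nested to the left. *)
Fixpoint view (i : nat) : measurableType (view_display i) :=
  if i is j.+1 then (view j * Y j * T)%type else T.

Variables (k : nat) (E : forall i : 'I_k, set (mechanism R X (Y i))).

(* The [adv_rand]s form the algorithm called R in the game; [adv_data] and
   [adv_mech] form D. The field [adv_measurable] makes the game well defined on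
   non-discrete spaces: the law of the outcome of a round has to be a Markov
   kernel of the preceding view. It always holds on countable discrete spaces. *)
Record adversary := Adversary {
  adv_rand0 : probability T R ;
  adv_rand : forall i : 'I_k, R.-pker (view i * Y i) ~> T ;
  adv_data : forall i : 'I_k, bool -> view i -> X ;
  adv_mech : forall i : 'I_k, view i -> mechanism R X (Y i) ;
  adv_sim : forall (i : 'I_k) (h : view i),
    sim (@adv_data i false h) (@adv_data i true h) ;
  adv_class : forall (i : 'I_k) (h : view i), @E i (@adv_mech i h) ;
  adv_measurable : forall (i : 'I_k) (b : bool),
    measurable_fun [set: view i]
      (fun h => @adv_mech i h (@adv_data i b h) : pprobability (Y i) R) }.

Fixpoint AdaComp_upto (A : adversary) (b : bool) (i : nat) :
    (i <= k)%N -> probability (view i) R :=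
  match i return (i <= k)%N -> probability (view i) R with
  | 0 => fun=> adv_rand0 A
  | j.+1 => fun jk : (j < k)%N =>
      semidirect
        (semidirect (AdaComp_upto A b (ltnW jk))
           (kprobability (@adv_measurable A (Ordinal jk) b)))
        (adv_rand A (Ordinal jk))
  end.

Definition AdaComp (A : adversary) (b : bool) : probability (view k) R :=
  AdaComp_upto A b (leqnn k).

End game.

Definition AdaComp_DP (k : nat) (E : forall i : 'I_k, set (mechanism R X (Y i)))
    (eps delta : R) :=
  forall (dT : measure_display) (T : measurableType dT) (A : adversary T E)
    (b : bool) (S : set (view T k)), measurable S ->
  (AdaComp A b S <= (expR eps)%:E * AdaComp A (~~ b) S + delta%:E)%E.

End adaptive_composition.

(* For delta = 0 the second entry of the minimum is +oo, so that the minimum is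
   the first entry (this needs a separate case since 0^-1 = 0). *)
Definition eps_g (R : realType) (k : nat) (eps : 'I_k -> R) (delta : R) : R :=
  let c (e : R) := e / (1 - expR (- e)) in
  if delta == 0 then \sum_(i < k) eps i
  else Num.min (\sum_(i < k) eps i)
    (\sum_(i < k) (c (eps i) - 1 - ln (c (eps i)))
     + Num.sqrt (2^-1 * (\sum_(i < k) eps i ^+ 2) * ln (1 / delta))).

(* Main.v *)
Require Import Defs.
From HB Require Import structures.
From mathcomp Require Import all_boot all_order all_algebra.
From mathcomp Require Import all_classical all_reals all_analysis.
From mathcomp Require Import measurable_realfun.
From mathcomp Require Import ring lra.

Set Implicit Arguments.
Unset Strict Implicit.
Unset Printing Implicit Defensive.
Import Order.TTheory GRing.Theory Num.Theory.
Import numFieldNormedType.Exports.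

Local Open Scope classical_set_scope.
Local Open Scope ring_scope.

(** Fix theta in (0, 1] and compare two laws P, Q through the inequality
    [int phi^theta dP <= B * (int phi dQ)^theta] for all [0,1]-valued [phi],
    the dual (Hölder) form of a bound on the Rényi divergence of order
    [1 / (1 - theta)]. The constants B multiply under adaptive composition, by
    integrating out one round at a time; working with test functions avoids the
    likelihood ratio of the views, which need not be jointly measurable in the
    history and the outcome.

    For one [eps]-bounded-range round the density ratio p/q lies in some
    interval [a, e^eps a], with a <= 1 <= e^eps a. For theta = 1 this gives
    B = e^eps. For theta < 1, Hölder's inequality reduces B to a moment of p/q,
    which the chord of the convex power function and Hoeffding's estimate for
    a Bernoulli variable bound in terms of a; optimising over a gives the mean
    c - 1 - ln c, where c = eps / (1 - e^-eps). Finally, with the optimal theta,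
    [P S <= B (Q S)^theta = delta^(1-theta) (e^s Q S)^theta <= delta + e^s Q S]. *)

(** * Integration against mixtures, densities and semidirect products *)

Section integral_mixture.
Local Open Scope ereal_scope.
Context (R : realType) d d' (H : measurableType d) (Z : measurableType d').
Variables (mu : {measure set H -> \bar R}) (K : H -> {measure set Z -> \bar R}).
Hypothesis mK : forall A, measurable A -> measurable_fun [set: H] (K ^~ A).
Variable m : {measure set Z -> \bar R}.
Hypothesis mE : forall A, measurable A -> m A = \int[mu]_h K h A.

Import HBNNSimple.

Lemma integral_mixture_nnsfun (f : {nnsfun Z >-> R}) :
  \int[m]_z (f z)%:E = \int[mu]_h \int[K h]_z (f z)%:E.
Proof.
under [RHS]eq_integral do rewrite integralT_nnsfun sintegralE.
have Kf_ge0 r h : 0 <= r%:E * K h (f @^-1` [set r]).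
  have [r0|r0] := leP 0%R r; first by rewrite mule_ge0.
  by rewrite preimage_nnfun0// measure0 mule0.
have mKf r : measurable_fun [set: H] (fun h => K h (f @^-1` [set r])).
  exact: mK.
rewrite ge0_integral_fsum//; last by move=> r; exact: measurable_funeM.
rewrite integralT_nnsfun sintegralE; apply: eq_fsbigr => r _; rewrite mE//.
have [r0|r0] := leP 0%R r; first by rewrite ge0_integralZl.
rewrite !integral0_eq ?mule0// => h _; rewrite preimage_nnfun0// measure0//.
by rewrite mule0.
Qed.

(** Simple functions first, then monotone convergence under both integrals; [mu] may be any measure,
    as reference measures of densities are arbitrary. *)
Lemma ge0_integral_mixture (f : Z -> \bar R) :
  (forall z, 0 <= f z) -> measurable_fun [set: Z] f ->
  \int[m]_z f z = \int[mu]_h \int[K h]_z f z.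
Proof.
move=> f0 mf; pose f_ := nnsfun_approx measurableT mf.
have fE (n : {measure set Z -> \bar R}) :
    \int[n]_z f z = limn (fun k => \int[n]_z (f_ k z)%:E).
  rewrite -monotone_convergence//.
  - by apply: eq_integral => z _; apply/esym/cvg_lim => //; exact: cvg_nnsfun_approx.
  - by move=> k; exact/measurable_EFinP.
  - by move=> k z _; rewrite lee_fin.
  - by move=> z _ a b ab; rewrite lee_fin; exact/lefP/nd_nnsfun_approx.
rewrite fE; under [RHS]eq_integral do rewrite fE.
rewrite monotone_convergence//.
- by congr (limn _); apply/funext => k; exact: integral_mixture_nnsfun.
- move=> k; apply: measurable_fun_integral_kernel => //.
    by move=> z; rewrite lee_fin.
  exact/measurable_EFinP.
- by move=> k h _; apply: integral_ge0 => z _; rewrite lee_fin.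
- move=> h _ a b ab; apply: ge0_le_integral => //.
  + by move=> z _; rewrite lee_fin.
  + exact/measurable_EFinP.
  + exact/measurable_EFinP.
  + by move=> z _; rewrite lee_fin; exact/lefP/nd_nnsfun_approx.
Qed.

End integral_mixture.

(** A measure with density [p] is the mixture over [mu] of the point masses [p y] at [y]. *)
Lemma integral_density (R : realType) d (Y : measurableType d)
    (mu m : {measure set Y -> \bar R}) (p : Y -> R) :
  measurable_fun [set: Y] p -> (forall y, 0 <= p y) ->
  (forall A, measurable A -> m A = (\int[mu]_(y in A) (p y)%:E)%E) ->
  forall f : Y -> \bar R, (forall y, (0 <= f y)%E) -> measurable_fun [set: Y] f ->
  (\int[m]_y f y = \int[mu]_y ((p y)%:E * f y))%E.
Proof.
move=> mp p0 mE f f0 mf.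
pose K y : {measure set Y -> \bar R} := mscale (NngNum (p0 y)) (\d_y).
have KE y A : K y A = ((p y)%:E * (\1_A y)%:E)%E by [].
rewrite (@ge0_integral_mixture _ _ _ _ _ mu K)//.
- apply: eq_integral => y _.
  by rewrite ge0_integral_mscale//= integral_dirac// diracT mul1e.
- move=> A mA; under eq_fun do rewrite KE.
  by apply: emeasurable_funM; apply/measurable_EFinP.
- move=> A mA; rewrite mE// integral_mkcond; apply: eq_integral => y _.
  by rewrite KE patchE indicE; case: ifPn; rewrite ?mule1 ?mule0.
Qed.

(** The semidirect product is the mixture over [mu] of the images of [K h] under [pair h]. *)
Lemma integral_semidirect (R : realType) d d' (H : measurableType d)
    (Z : measurableType d') (mu : probability H R) (K : R.-pker H ~> Z)
    (f : H * Z -> \bar R) :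
  (forall x, (0 <= f x)%E) -> measurable_fun [set: H * Z] f ->
  (\int[semidirect mu K]_x f x = \int[mu]_h \int[K h]_z f (h, z))%E.
Proof.
move=> f0 mf.
pose L_ h : {measure set (H * Z) -> \bar R} := pushforward (K h) (pair h).
pose L := L_ (@pair1_measurable _ _ H Z).
have LE h A : L h A = K h (xsection A h) by rewrite xsectionE.
rewrite (@ge0_integral_mixture _ _ _ _ _ mu L)//.
- by apply: eq_integral => h _; rewrite ge0_integral_pushforward//;
    exact: pair1_measurable.
- move=> A mA; under eq_fun do rewrite LE.
  by apply: measurable_fun_xsection_finite_kernel; rewrite inE.
- by move=> A mA; apply: eq_integral => h _; rewrite LE.
Qed.

(** * Power domination between two measures *)

Section power_dominated.
Context (R : realType).

(* At [phi] an indicator function this reads [P S <= B * Q S `^ theta]. *)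
Definition power_dominated (theta B : R) d (Z : measurableType d)
    (P Q : {measure set Z -> \bar R}) :=
  forall phi : Z -> R, measurable_fun [set: Z] phi ->
    (forall z, 0 <= phi z <= 1) ->
  (\int[P]_z (phi z `^ theta)%:E <= B%:E * (\int[Q]_z (phi z)%:E) `^ theta)%E.

(** Hölder's inequality with exponents [1 / theta] and [1 / (1 - theta)], for the factors
    [(q phi)^theta] and [p q^(-theta)] of [p phi^theta]. The integral bounded by [C] is the moment
    of order [1 / (1 - theta)] of [p / q] under [Q]. *)
Lemma power_dominated_hoelder d (Z : measurableType d)
    (mu P Q : {measure set Z -> \bar R}) (p q : Z -> R) (theta C : R) :
  measurable_fun [set: Z] p -> (forall z, 0 <= p z) ->
  (forall A, measurable A -> P A = (\int[mu]_(z in A) (p z)%:E)%E) ->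
  measurable_fun [set: Z] q -> (forall z, 0 <= q z) ->
  (forall A, measurable A -> Q A = (\int[mu]_(z in A) (q z)%:E)%E) ->
  (forall z, q z = 0 -> p z = 0) ->
  0 < theta < 1 -> 0 <= C ->
  (\int[mu]_z ((p z * q z `^ (- theta)) `^ (1 - theta)^-1)%:E <= C%:E)%E ->
  power_dominated theta (C `^ (1 - theta)) P Q.
Proof.
move=> mp p0 PE mq q0 QE qp /andP[t0 t1] C0 intC phi mphi phi01.
have t'0 : 0 < 1 - theta by rewrite subr_gt0.
have phi0 z : 0 <= phi z by case/andP: (phi01 z).
rewrite (integral_density mp p0 PE)//; last 2 first.
  by move=> z; rewrite lee_fin powR_ge0.
  by apply/measurable_EFinP; apply: measurableT_comp (measurable_powR _) mphi.
rewrite (integral_density mq q0 QE)//; last exact/measurable_EFinP.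
pose f z := (q z * phi z) `^ theta; pose g z := p z * q z `^ (- theta).
have mf : measurable_fun [set: Z] f.
  apply: measurableT_comp (measurable_powR _) _.
  exact: measurable_funM.
have mg : measurable_fun [set: Z] g.
  apply: measurable_funM => //.
  exact: measurableT_comp (measurable_powR _) _.
have fg z : f z * g z = p z * phi z `^ theta.
  rewrite /f /g; have [qz|qz] := eqVneq (q z) 0.
    by rewrite qp// !mul0r mulr0.
  by rewrite powRM// powRN; field; rewrite powR_eq0 negb_and qz.
have : ('N[mu]_1[EFin \o (f \* g)%R] <=
    'N[mu]_(theta^-1)%:E[EFin \o f] * 'N[mu]_((1 - theta)^-1)%:E[EFin \o g])%E.
  by apply: hoelder => //; rewrite ?invr_gt0// !invrK addrC subrK.
rewrite Lnorm1 unlock !invrK.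
rewrite (eq_integral (fun z => ((p z)%:E * (phi z `^ theta)%:E)%E)); last first.
  by move=> z _ /=; rewrite fg -EFinM ger0_norm// mulr_ge0// powR_ge0.
rewrite [in leRHS](eq_integral (fun z => ((q z)%:E * (phi z)%:E)%E)); last first.
  move=> z _ /=; rewrite ger0_norm ?powR_ge0// -powRrM divff ?gt_eqF//.
  by rewrite powRr1// mulr_ge0.
move=> /le_trans; apply; rewrite muleC; apply: lee_wpmul2r.
  exact: poweR_ge0.
rewrite -poweR_EFin; apply: (@gt0_ler_poweR R (1 - theta)); first exact: ltW.
- by rewrite in_itv/= leey andbT; apply: integral_ge0 => z _; rewrite lee_fin powR_ge0.
- by rewrite in_itv/= leey andbT lee_fin.
- apply: le_trans intC; rewrite le_eqVlt; apply/orP; left; apply/eqP.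
  apply: eq_integral => z _ /=.
  by rewrite ger0_norm// mulr_ge0// powR_ge0.
Qed.

(** For [theta < 1] this is Jensen's inequality, obtained from Hölder's with both densities equal to
    1. It accounts for the adversary's own coins, drawn from the same kernels in both games. *)
Lemma power_dominated_refl d (Z : measurableType d)
    (P : {measure set Z -> \bar R}) (theta : R) :
  P [set: Z] = 1%E -> 0 < theta <= 1 -> power_dominated theta 1 P P.
Proof.
move=> P1 /andP[t0]; rewrite le_eqVlt => /predU1P[->|t1].
  move=> phi mphi phi01; rewrite mul1e poweRe1; last first.
    by apply: integral_ge0 => z _; rewrite lee_fin; case/andP: (phi01 z).
  rewrite le_eqVlt; apply/orP; left; apply/eqP; apply: eq_integral => z _.
  by rewrite powRr1//; case/andP: (phi01 z).
have PE (A : set Z) : measurable A -> P A = (\int[P]_(z in A) 1%:E)%E.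
  by move=> mA; rewrite integral_cst// mul1e.
rewrite (_ : 1 = 1 `^ (1 - theta)); last by rewrite powR1.
apply: (@power_dominated_hoelder _ _ P _ _ (cst 1) (cst 1)) => //=.
- by rewrite t0.
- by under eq_integral do rewrite powR1 mul1r powR1; rewrite -PE// P1.
Qed.

(** Integrating [z] out for fixed [h] leaves [C] times the power [theta] of [G h], the [L h]-mean of
    [phi]. As [G] is again a [0,1]-valued test function, the bound for [mu] and [nu] applies to
    it. *)
Lemma power_dominated_semidirect d d' (H : measurableType d)
    (Z : measurableType d') (mu nu : probability H R) (K L : R.-pker H ~> Z)
    (theta B C : R) :
  0 <= theta -> 0 <= B -> 0 <= C -> power_dominated theta B mu nu ->
  (forall h, power_dominated theta C (K h) (L h)) ->
  power_dominated theta (B * C) (semidirect mu K) (semidirect nu L).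
Proof.
move=> t0 B0 C0 domH domZ phi mphi phi01.
have phi0 x : 0 <= phi x by case/andP: (phi01 x).
have mphi_h h : measurable_fun [set: Z] (fun z => phi (h, z)).
  exact: measurableT_comp mphi (pair1_measurable h).
pose G h := (\int[L h]_z (phi (h, z))%:E)%E.
have G0 h : (0 <= G h)%E by apply: integral_ge0 => z _; rewrite lee_fin.
have G1 h : (G h <= 1)%E.
  rewrite -(@prob_kernel _ _ _ _ _ L h) -[leRHS]mul1e -integral_cst//.
  apply: ge0_le_integral => //; first by move=> z _; rewrite lee_fin.
  - exact/measurable_EFinP.
  - by move=> z _; rewrite lee_fin; case/andP: (phi01 (h, z)).
have GE h : G h = (fine (G h))%:E.
  by rewrite fineK// ge0_fin_numE// (le_lt_trans (G1 h))// ltry.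
have mG : measurable_fun [set: H] G.
  apply: (measurable_fun_integral_finite_kernel (fun x => (phi x)%:E) L) => //.
  exact/measurable_EFinP.
have mg : measurable_fun [set: H] (fine \o G) by exact: measurableT_comp.
have mphit : measurable_fun [set: H * Z] (fun x => (phi x `^ theta)%:E).
  by apply/measurable_EFinP; apply: measurableT_comp (measurable_powR _) mphi.
rewrite integral_semidirect//; last by move=> x; rewrite lee_fin powR_ge0.
rewrite integral_semidirect//; last exact/measurable_EFinP.
apply: (@le_trans _ _ (\int[mu]_h (C%:E * ((fine \o G) h `^ theta)%:E))%E).
  apply: ge0_le_integral => //.
  - by move=> h _; apply: integral_ge0 => z _; rewrite lee_fin powR_ge0.
  - apply: (measurable_fun_integral_finite_kernel _ K) mphit.
    by move=> x; rewrite lee_fin powR_ge0.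
  - apply: measurable_funeM; apply/measurable_EFinP.
    exact: measurableT_comp (measurable_powR _) mg.
  - move=> h _; rewrite -poweR_EFin -GE.
    by apply: domZ => // z; exact: phi01.
rewrite ge0_integralZl_EFin//; last 2 first.
- by move=> h _; rewrite lee_fin powR_ge0.
- by apply/measurable_EFinP; exact: measurableT_comp (measurable_powR _) mg.
rewrite mulrC EFinM -muleA lee_wpmul2l// ?lee_fin//.
rewrite [in leRHS](eq_integral (fun h => ((fine \o G) h)%:E)); last first.
  by move=> h _; exact: GE.
by apply: domH => // h /=; rewrite -!lee_fin -GE G0 G1.
Qed.

End power_dominated.

(** * Hoeffding's estimate for a Bernoulli variable *)

Section scalar_inequalities.
Context (R : realType).

Lemma is_derive_ndecr (f f' : R -> R) :
  (forall x : R, 0 <= x -> is_derive x 1 f (f' x)) -> (forall x, 0 <= x -> 0 <= f' x) ->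
  forall h, 0 <= h -> f 0 <= f h.
Proof.
move=> df f'0 h h0; apply: (@ger0_derive1_ndecry _ f 0) => //.
- move=> x; rewrite in_itv/= andbT => /ltW x0.
  by apply: ex_derive; exact: df.
- move=> x; rewrite in_itv/= andbT => /ltW x0.
  by have dfx := df x x0; rewrite derive1E derive_val f'0.
- apply: derivable_within_continuous => x; rewrite in_itv/= andbT => x0.
  by apply: ex_derive; exact: df.
Qed.

(** The exponent minus the logarithm of the left side, [f2], vanishes at 0, and so does its
    derivative [f1]; the derivative of [f1] is nonnegative by AM-GM for the two summands of
    [D x]. *)
Lemma bernoulli_mgf_le (u h : R) : 0 <= u <= 1 -> 0 <= h ->
  1 - u + u * expR h <= expR (u * h + h ^+ 2 / 8).
Proof.
move=> /andP[u0 u1] h0.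
pose D (x : R) := 1 - u + u * expR x.
have D0 x : 0 < D x.
  have := expR_gt0 x; rewrite /D; have [->|un0] := eqVneq u 0; first by lra.
  by move=> ?; rewrite ltr_wpDl ?subr_ge0// mulr_gt0// lt0r un0.
have dD (x : R) : is_derive x 1 D (u * expR x).
  rewrite /D; apply: is_derive_eq.
  by rewrite add0r mul1r.
pose f1 x := u + x / 4 - u * expR x / D x.
pose f2 x := u * x + x ^+ 2 / 8 - ln (D x).
have f1_ge0 (x : R) (x0 : 0 <= x) : 0 <= f1 x.
  have f10 : f1 0 = 0 by rewrite /f1 /D expR0; field; lra.
  pose f1' x := 4^-1 - u * (1 - u) * expR x / D x ^+ 2.
  rewrite -f10; apply: (is_derive_ndecr (f' := f1')) x0 => {}x x0.

    have dV : is_derive x 1 (fun y => (D y)^-1) (- (D x) ^- 2 *: (u * expR x)).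
      by apply: is_deriveV; rewrite ?gt_eqF.
    rewrite /f1; apply: is_derive_eq.
    rewrite /f1' /GRing.scale/=; have := D0 x; rewrite /D => Dx; field.
    by rewrite gt_eqF.
  rewrite /f1' subr_ge0 ler_pdivrMr ?exprn_gt0// /D.
  by have := sqr_ge0 (1 - u - u * expR x); lra.
suff : 0 <= f2 h.
  rewrite subr_ge0 => lnD; rewrite -/(D h) -[leLHS]lnK ?posrE//.
  by rewrite ler_expR.
have f20 : f2 0 = 0 by rewrite /f2 /D expR0 mulr1 subrK ln1; ring.
rewrite -f20; apply: (is_derive_ndecr (f' := f1)) h0 => x x0; last exact: f1_ge0.
have dln : is_derive x 1 (@ln R \o D) ((D x)^-1 * (u * expR x)).
  by apply: is_derive1_comp; exact: is_derive1_ln.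
rewrite /f2; apply: is_derive_eq.
rewrite /f1/GRing.scale/=; field.
by rewrite gt_eqF.
Qed.

End scalar_inequalities.

(** * Moments of a two-valued density ratio *)

Section bounded_range_moment.
Context (R : realType).

Lemma powR_le_chord (a b x r : R) : 0 <= a -> a < b -> a <= x <= b -> 1 <= r ->
  x `^ r <= (a `^ r * (b - x) + b `^ r * (x - a)) / (b - a).
Proof.
move=> a0 ab /andP[ax xb] r1; have ba0 : 0 < b - a by rewrite subr_gt0.
pose t := (b - x) / (b - a).
have t0 : 0 <= t by rewrite divr_ge0 ?subr_ge0// ltW.
have t1 : t <= 1 by rewrite ler_pdivrMr// mul1r lerB.
have -> : x = t * a + (1 - t) * b by rewrite /t; field; rewrite gt_eqF.
have H : (t * a + (1 - t) * b) `^ r <= t * a `^ r + (1 - t) * b `^ r.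
  apply: (convex_powR r1 (Itv01 t0 t1)); rewrite inE/= in_itv/= andbT//.
  exact: ltW (le_lt_trans a0 ab).
apply: (le_trans H); rewrite le_eqVlt; apply/orP; left; apply/eqP.
by rewrite /t; field; rewrite gt_eqF.
Qed.

(** The left side is the moment of order [1 + lam] of a variable with values [a], [b] and mean 1.
    Reweighting by the variable itself turns it into the power [lam] of [a] times a Bernoulli moment
    generating function. *)
Lemma bounded_range_moment (eps lam a : R) :
  let b := expR eps * a in let c := eps / (1 - expR (- eps)) in
  0 < eps -> 0 < lam -> 0 < a -> a <= 1 <= b ->
  (a `^ (1 + lam) * (b - 1) + b `^ (1 + lam) * (1 - a)) / (b - a) <=
  expR (lam * (c - 1 - ln c) + lam ^+ 2 * eps ^+ 2 / 8).
Proof.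
move=> b c eps0 lam0 a0 /andP[a1 b1].
have X1 : 1 < expR eps by rewrite expR_gt1.
have X0 := expR_gt0 eps.
(* The mass of [b] after reweighting, [b * (1 - a) / (b - a)]. *)
pose u := (1 - a) * expR eps / (expR eps - 1).
have cE : c = eps * expR eps / (expR eps - 1).
  by rewrite /c expRN; field; rewrite !gt_eqF ?subr_gt0//=.
have c0 : 0 < c by rewrite cE divr_gt0 ?mulr_gt0// subr_gt0.
have u0 : 0 <= u by rewrite /u divr_ge0 ?mulr_ge0 ?subr_ge0// ltW.
have u1 : u <= 1.
  by rewrite /u ler_pdivrMr ?subr_gt0// mul1r; move: b1; rewrite /b; lra.
have -> : (a `^ (1 + lam) * (b - 1) + b `^ (1 + lam) * (1 - a)) / (b - a) =
    a `^ lam * (1 - u + u * expR (lam * eps)).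
  rewrite powRM ?(ltW a0) ?(ltW X0)// !powRD ?[_ + _ == 0]gt_eqF ?addr_gt0//.
  rewrite !powRr1 ?(ltW a0) ?(ltW X0)//.
  have -> : expR eps `^ lam = expR (lam * eps) by rewrite mulrC expRM.
  rewrite /u /b; field; rewrite ?gt_eqF ?subr_gt0//.
  by rewrite ltr_pMl.
have H : 1 - u + u * expR (lam * eps) <=
    expR (u * (lam * eps) + (lam * eps) ^+ 2 / 8).
  by apply: bernoulli_mgf_le; rewrite ?u0// mulr_ge0// ltW.
have -> : a `^ lam = expR (lam * ln a) by rewrite mulrC expRM lnK ?posrE.
rewrite (le_trans (ler_wpM2l (expR_ge0 _) H))// -expRD ler_expR.
have ac0 : a * c \in Num.pos by rewrite posrE mulr_gt0.
(* This is [ln t <= t - 1] at [t = a * c], with equality at the worst case [a = 1 / c]. *)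
have lnac : 1 + (ln a + ln c) <= a * c.
  have := expR_ge1Dx (ln (a * c)); rewrite (lnK ac0).
  by rewrite [ln _]lnM ?posrE.
have : ln a + u * eps <= c - 1 - ln c.
  have -> : u * eps = c - a * c.
    by rewrite cE /u; field; rewrite gt_eqF ?subr_gt0.
  by lra.
move/(ler_wpM2l (ltW lam0)) => H2.
by rewrite -exprMn; lra.
Qed.

End bounded_range_moment.

(** * Density ratios confined to an interval *)

Section bounded_range_dominated.
Context (R : realType) d (Y : measurableType d).

(** Take for [a] the infimum of [p / q] over the points where [q] is nonzero: by hypothesis any two
    such ratios differ by a factor at most [c]. *)
Lemma bounded_range_ratio (p q : Y -> R) (c : R) : 0 < c ->
  (forall y, 0 <= p y) -> (forall y, 0 <= q y) ->
  (exists y, p y != 0) -> (exists y, q y != 0) ->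
  (forall y1 y2, p y1 * q y2 <= c * (p y2 * q y1)) ->
  exists2 a, 0 < a & forall y, a * q y <= p y <= c * a * q y.
Proof.
move=> c0 p0 q0 [yp pyp] [yq qyq] pq.
have qp y : q y = 0 -> p y = 0.
  move=> qy; have := pq y yq; rewrite qy !mulr0 => py.
  apply/eqP; rewrite -[_ == _]orbF -(negbTE qyq) -mulf_eq0 eq_le py.
  by rewrite mulr_ge0.
have qpos y : q y != 0 -> 0 < q y by move=> qy; rewrite lt0r qy q0.
pose S := [set p y / q y | y in [set y | q y != 0]].
have ratio y z : q y != 0 -> q z != 0 -> p y / q y <= c * (p z / q z).
  move=> qy qz; rewrite ler_pdivrMr ?qpos// mulrA mulrAC ler_pdivlMr ?qpos//.
  by rewrite -mulrA.
have S0 : S !=set0 by exists (p yq / q yq), yq.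
have S_lb : has_lbound S by exists 0 => _ [y _ <-]; rewrite divr_ge0.
have infS y : q y != 0 -> p y / q y / c <= inf S.
  move=> qy; apply: lb_le_inf => // _ [z qz <-].
  by rewrite ler_pdivrMr// [leRHS]mulrC ratio.
(* The infimum is positive: [infS] at a point where [p] is nonzero bounds it below by a positive
   number. *)
exists (inf S).
  have qyp : q yp != 0 by apply: contra pyp => /eqP/qp ->.
  by apply: lt_le_trans (infS _ qyp); rewrite !divr_gt0 ?qpos// lt0r pyp p0.
move=> y; have [qy|qy] := eqVneq (q y) 0; first by rewrite qp// qy !mulr0 lexx.
apply/andP; split.
  by rewrite -ler_pdivlMr ?qpos//; apply: ge_inf => //; exists y.
by rewrite -ler_pdivrMr ?qpos// [leRHS]mulrC -ler_pdivrMr// infS.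
Qed.

Variables (mu : {measure set Y -> \bar R}) (P Q : probability Y R).
Variables (p q : Y -> R).
Hypotheses (mp : measurable_fun [set: Y] p) (p0 : forall y, 0 <= p y).
Hypothesis PE : forall A, measurable A -> P A = (\int[mu]_(y in A) (p y)%:E)%E.
Hypotheses (mq : measurable_fun [set: Y] q) (q0 : forall y, 0 <= q y).
Hypothesis QE : forall A, measurable A -> Q A = (\int[mu]_(y in A) (q y)%:E)%E.
Variables (a b : R).
Hypotheses (a0 : 0 < a) (apb : forall y, a * q y <= p y <= b * q y).

Let intp : (\int[mu]_y (p y)%:E = 1)%E.
Proof. by rewrite -PE// probability_setT. Qed.

Let intq : (\int[mu]_y (q y)%:E = 1)%E.
Proof. by rewrite -QE// probability_setT. Qed.

(** Integrate [a * q <= p]: both densities have mass 1. *)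
Lemma density_ratio_le1 : a <= 1.
Proof.
rewrite -lee_fin -intp -[leLHS]mule1 -intq -ge0_integralZl_EFin//.
- apply: ge0_le_integral => //.
  + by move=> y _; rewrite -EFinM lee_fin mulr_ge0// ltW.
  + by apply: measurable_funeM; exact/measurable_EFinP.
  + exact/measurable_EFinP.
  + by move=> y _; rewrite -EFinM lee_fin; case/andP: (apb y).
- by move=> y _; rewrite lee_fin.
- exact/measurable_EFinP.
- exact: ltW.
Qed.

Lemma density_ratio_ge1 : 1 <= b.
Proof.
(* A negative [b] would force [p = 0]; otherwise [b] can be pulled out of the integral. *)
have [b_lt0|b0] := ltP b 0.
  have : (\int[mu]_y (p y)%:E = 0)%E.
    apply: integral0_eq => y _; congr EFin; apply/eqP; rewrite eq_le p0 andbT.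
    by case/andP: (apb y) => _ /le_trans; apply; rewrite mulr_le0_ge0// ltW.
  by rewrite intp => -[] /eqP; rewrite oner_eq0.
rewrite -lee_fin -intp -[leRHS]mule1 -intq -ge0_integralZl_EFin//.
- apply: ge0_le_integral => //.
  + by move=> y _; rewrite lee_fin.
  + exact/measurable_EFinP.
  + by apply: measurable_funeM; exact/measurable_EFinP.
  + by move=> y _; rewrite -EFinM lee_fin; case/andP: (apb y).
- by move=> y _; rewrite lee_fin.
- exact/measurable_EFinP.
Qed.

(** The integrand is [q] times the power [r] of [p / q]. Bounding this power by its chord over
    [a, b], of slope [A] and intercept [B], leaves [A * p + B * q], whose integral is [A + B]. *)
Lemma integral_density_power (r : R) : a < b -> 1 < r ->
  (\int[mu]_y ((p y * q y `^ (- (1 - r^-1))) `^ r)%:E <=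
   ((a `^ r * (b - 1) + b `^ r * (1 - a)) / (b - a))%:E)%E.
Proof.
move=> ab r1; have r0 : 0 < r by exact: lt_trans r1.
have ba0 : 0 < b - a by rewrite subr_gt0.
pose A := (b `^ r - a `^ r) / (b - a).
pose B := (a `^ r * b - b `^ r * a) / (b - a).
have pt y : (p y * q y `^ (- (1 - r^-1))) `^ r <= A * p y + B * q y.
  have [qy|qy] := eqVneq (q y) 0.
    have := apb y; rewrite qy !mulr0 -eq_le => /eqP <-.
    by rewrite !mul0r mulr0 addr0 powR0// gt_eqF.
  have qy0 : 0 < q y by rewrite lt0r qy q0.
  have -> : (p y * q y `^ (- (1 - r^-1))) `^ r = (p y / q y) `^ r * q y.
    have rE : (r^-1 - 1) * r = - r + 1 by field; rewrite gt_eqF.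
    rewrite opprB -(powR_inv1 (q0 y)) !powRM ?powR_ge0// -!powRrM rE mulN1r.
    by rewrite powRD ?qy ?implybT// powRr1// mulrA.
  have /powR_le_chord : a <= p y / q y <= b.
    by rewrite ler_pdivlMr// ler_pdivrMr.
  move=> /(_ r (ltW a0) ab (ltW r1)) /(ler_wpM2r (ltW qy0)) /le_trans; apply.
  rewrite le_eqVlt; apply/orP; left; apply/eqP; rewrite /A /B; field.
  by rewrite qy gt_eqF.
have integrable_density (f : Y -> R) : measurable_fun [set: Y] f ->
    (forall y, 0 <= f y) -> (\int[mu]_y (f y)%:E = 1)%E ->
    mu.-integrable [set: Y] (fun y => (f y)%:E).
  move=> mf f0 f1; apply/integrableP; split; first exact/measurable_EFinP.
  by under eq_integral do rewrite gee0_abs ?lee_fin//; rewrite f1 ltry.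
have ip := integrable_density _ mp p0 intp.
have iq := integrable_density _ mq q0 intq.
have -> : ((a `^ r * (b - 1) + b `^ r * (1 - a)) / (b - a))%:E =
    (\int[mu]_y (A%:E * (p y)%:E + B%:E * (q y)%:E))%E.
  rewrite integralD//; [|exact: integrableZl..].
  rewrite !integralZl//.
  rewrite intp intq !mule1 -EFinD; congr EFin; rewrite /A /B; field.
  by rewrite gt_eqF.
apply: ge0_le_integral => //.
- by move=> y _; rewrite lee_fin powR_ge0.
- apply/measurable_EFinP; apply: measurableT_comp (measurable_powR _) _.
  apply: measurable_funM => //.
  exact: measurableT_comp (measurable_powR _) _.
- by apply: emeasurable_funD; apply: measurable_funeM; exact/measurable_EFinP.
- by move=> y _; rewrite -!EFinM -EFinD lee_fin.
Qed.

End bounded_range_dominated.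

(** * Domination for one mechanism, then for the composed game *)

Definition bounded_range_mean (R : realType) (eps : R) : R :=
  let c := eps / (1 - expR (- eps)) in c - 1 - ln c.

Section composition.
Context (R : realType) (X : Type) (sim : X -> X -> Prop).

Lemma bounded_range_density d (Y : measurableType d) (eps : R)
    (M : mechanism R X Y) (x x' : X) :
  bounded_range sim Y eps M -> sim x x' ->
  exists (mu : {measure set Y -> \bar R}) (p q : Y -> R) (a : R),
    [/\ [/\ measurable_fun [set: Y] p, forall y, 0 <= p y
          & forall A, measurable A -> M x A = (\int[mu]_(y in A) (p y)%:E)%E],
        [/\ measurable_fun [set: Y] q, forall y, 0 <= q y
          & forall A, measurable A -> M x' A = (\int[mu]_(y in A) (q y)%:E)%E],
        0 < a & forall y, a * q y <= p y <= expR eps * a * q y].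
Proof.
move=> [mu [p [dens pp]]] xx'.
have nz z : exists y, p z y != 0.
  apply: contrapT => /forallNP pz0; have [_ _ /(_ setT measurableT)] := dens z.
  rewrite probability_setT integral0_eq => [/eqP|y _].
    by rewrite onee_eq0.
  by have /negP/negPn/eqP -> := pz0 y.
have [mp p0 PE] := dens x; have [mq q0 QE] := dens x'.
have [a a0 apq] := bounded_range_ratio (expR_gt0 eps) p0 q0 (nz x) (nz x')
  (pp x x' xx').
by exists mu, (p x), (p x'), a.
Qed.

(** Since [a <= 1], the upper bound on [p] is at most [expR eps * q]. *)
Lemma bounded_range_pure d (Y : measurableType d) (eps : R)
    (M : mechanism R X Y) (x x' : X) :
  bounded_range sim Y eps M -> sim x x' ->
  power_dominated 1 (expR eps) (M x) (M x').
Proof.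
move=> brM xx'; have [mu [p [q [a]]]] := bounded_range_density brM xx'.
move=> [[mp p0 PE] [mq q0 QE] a0 apq] phi mphi phi01.
have phi0 y : 0 <= phi y by case/andP: (phi01 y).
have a1 := density_ratio_le1 mp PE mq q0 QE a0 apq.
rewrite poweRe1; last by apply: integral_ge0 => y _; rewrite lee_fin.
under eq_integral do rewrite powRr1//.
have mEphi : measurable_fun [set: Y] (EFin \o phi) by exact/measurable_EFinP.
rewrite (integral_density mp p0 PE)// (integral_density mq q0 QE)//.
rewrite -ge0_integralZl_EFin ?expR_ge0//; last 2 first.
- by move=> y _; rewrite -EFinM lee_fin mulr_ge0.
- by apply/measurable_EFinP; exact: measurable_funM.
apply: ge0_le_integral => //.
- by move=> y _; rewrite -EFinM lee_fin mulr_ge0.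
- by apply/measurable_EFinP; exact: measurable_funM.
- by apply/measurable_EFinP; apply: measurable_funM => //; exact: measurable_funM.
- move=> y _; rewrite -!EFinM lee_fin mulrA ler_wpM2r//.
  case/andP: (apq y) => _ /le_trans; apply; rewrite ler_wpM2r//.
  by rewrite ler_piMr// expR_ge0.
Qed.

Lemma bounded_range_power_dominated d (Y : measurableType d) (eps theta : R)
    (M : mechanism R X Y) (x x' : X) :
  0 < eps -> 0 < theta < 1 -> bounded_range sim Y eps M -> sim x x' ->
  power_dominated theta
    (expR (theta * bounded_range_mean eps +
           theta ^+ 2 / (1 - theta) * (eps ^+ 2 / 8))) (M x) (M x').
Proof.
move=> eps0 theta01 brM xx'; have [mu [p [q [a]]]] := bounded_range_density brM xx'.
have /andP[t0 t1] := theta01; have t'0 : 0 < 1 - theta by rewrite subr_gt0.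
move=> [[mp p0 PE] [mq q0 QE] a0 apq].
have a1 := density_ratio_le1 mp PE mq q0 QE a0 apq.
have b1 := density_ratio_ge1 mp p0 PE mq q0 QE apq.
(* With this [lam] the moment order [1 + lam] is the Hölder exponent [1 / (1 - theta)]. *)
pose lam := theta / (1 - theta).
have lam0 : 0 < lam by rewrite divr_gt0.
have lamE : 1 + lam = (1 - theta)^-1.
  by rewrite /lam; field; rewrite gt_eqF.
have ab : a < expR eps * a by rewrite ltr_pMl// expR_gt1.
have -> : theta * bounded_range_mean eps + theta ^+ 2 / (1 - theta) * (eps ^+ 2 / 8) =
    (lam * bounded_range_mean eps + lam ^+ 2 * eps ^+ 2 / 8) * (1 - theta).
  by rewrite /lam; field; rewrite gt_eqF.
rewrite expRM.
apply: (power_dominated_hoelder mp p0 PE mq q0 QE) => //.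
  by move=> y qy; have := apq y; rewrite qy !mulr0 -eq_le => /eqP.
have r1 : 1 < (1 - theta)^-1 by rewrite -lamE ltrDl.
have := integral_density_power mp p0 PE mq q0 QE a0 apq ab r1.
rewrite invrK subKr => /le_trans; apply; rewrite lee_fin -lamE.
by apply: bounded_range_moment => //; rewrite a1.
Qed.

Context (dY : nat -> measure_display) (Y : forall i, measurableType (dY i)).
Context (k : nat) (E : forall i : 'I_k, set (mechanism R X (Y i))).
Arguments E : clear implicits.

(** Induction on the rounds. Each round adds two semidirect products: the outcome costs the factor
    [expR (f i)], the adversary's coins the factor 1. *)
Lemma AdaComp_power_dominated (theta : R) (f : 'I_k -> R) dT
    (T : measurableType dT) (A : adversary sim T E) (b : bool) :
  (forall x x', sim x x' -> sim x' x) -> 0 < theta <= 1 ->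
  (forall (i : 'I_k) (M : mechanism R X (Y i)) (x x' : X), E i M -> sim x x' ->
    power_dominated theta (expR (f i)) (M x) (M x')) ->
  power_dominated theta (expR (\sum_(i < k) f i)) (AdaComp A b) (AdaComp A (~~ b)).
Proof.
move=> sim_sym theta01 domE.
have t0 : 0 <= theta by case/andP: theta01 => /ltW.
have -> : \sum_(i < k) f i = \sum_(i < k | (i < k)%N) f i.
  by apply: eq_bigl => i; rewrite ltn_ord.
suff upto i (ik : (i <= k)%N) : power_dominated theta
    (expR (\sum_(j < k | (j < i)%N) f j))
    (AdaComp_upto A b ik) (AdaComp_upto A (~~ b) ik) by exact: upto.
elim: i ik => [|i IH] ik /=.
  by rewrite big_pred0// expR0; apply: power_dominated_refl => //; exact: probability_setT.
rewrite -[expR _]mulr1; apply: power_dominated_semidirect => //.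
- rewrite (bigD1 (Ordinal ik))//= addrC expRD.
  apply: power_dominated_semidirect => //.
    rewrite (eq_bigl (fun j : 'I_k => (j < i)%N)); first exact: IH.
    by move=> j; rewrite ltnS ltn_neqAle andbC.
  move=> h; apply: domE; first exact: adv_class.
  (* For [b = true] the two datasets come in reverse order, hence the symmetry of [sim]. *)
  by case: b {IH}; [apply: sim_sym|]; exact: adv_sim.
- by move=> h; apply: power_dominated_refl => //; exact: prob_kernel.
Qed.

End composition.

(** * From power domination to approximate privacy *)

Section approximate_privacy.
Context (R : realType) d (Z : measurableType d) (P Q : probability Z R).

(** The indicator of [S] is its own power of exponent [theta], except at [theta = 0], where 0 to the
    power 0 is 1. *)
Lemma power_dominated_set (theta B : R) (S : set Z) :
  theta != 0 -> measurable S -> power_dominated theta B P Q ->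
  (P S <= (B * fine (Q S) `^ theta)%:E)%E.
Proof.
move=> t0 mS dom.
have := dom \1_S (measurable_indic mS).
rewrite integral_indic// setIT => H.
rewrite EFinM -poweR_EFin fineK ?fin_num_measure//.
apply: le_trans (H _); last by move=> z; rewrite indicE; case: (_ \in _); rewrite lexx ler01.
rewrite -[in leLHS](setIT S) -integral_indic// le_eqVlt; apply/orP; left.
apply/eqP; apply: eq_integral => z _; rewrite indicE.
by case: (_ \in _); rewrite ?powR1// powR0.
Qed.

Lemma power_dominated_approx (m V delta : R) (S : set Z) :
  0 < V -> 0 < delta < 1 -> measurable S ->
  (forall theta, 0 < theta < 1 ->
    power_dominated theta
      (expR (theta * m + theta ^+ 2 / (1 - theta) * (V / 8))) P Q) ->
  (P S <= (expR (m + Num.sqrt (2^-1 * V * ln (1 / delta))))%:E * Q S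
          + delta%:E)%E.
Proof.
move=> V0 /andP[d0 d1] mS dom.
set w := Num.sqrt _; set s := m + w.
have lnd : ln delta < 0 by rewrite ln_lt0// d0.
have l0 : 0 < 2^-1 * V * ln (1 / delta).
  by rewrite div1r lnV ?posrE// !mulr_gt0// oppr_gt0.
have w0 : 0 < w by rewrite sqrtr_gt0.
have w2 : w ^+ 2 = - (2^-1 * V * ln delta).
  by rewrite sqr_sqrtr ?ltW// div1r lnV ?posrE// mulrN.
(* [theta / (1 - theta) = 4 * w / V] minimises the exponent of the Chernoff bound. *)
pose theta := 4 * w / (V + 4 * w).
have Vw0 : 0 < V + 4 * w by lra.
have t0 : 0 < theta by rewrite divr_gt0// mulr_gt0.
have t'E : 1 - theta = V / (V + 4 * w) by rewrite /theta; field; rewrite gt_eqF.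
have t1 : theta < 1 by rewrite -subr_gt0 t'E divr_gt0.
(* The constant thus becomes [expR (s * theta)] times the power [1 - theta] of [delta]. *)
have BE : theta * m + theta ^+ 2 / (1 - theta) * (V / 8) =
    s * theta + ln delta * (1 - theta).
  have -> : ln delta = - (2 * w ^+ 2 / V) by rewrite w2; field; rewrite gt_eqF.
  rewrite t'E /s /theta; field; rewrite !gt_eqF//.
have tn0 : theta != 0 by rewrite gt_eqF.
have theta01 : 0 < theta < 1 by rewrite t0.
apply: (le_trans (power_dominated_set tn0 mS (dom theta theta01))).
have -> : Q S = (fine (Q S))%:E by rewrite fineK// fin_num_measure.
have := fine_ge0 (measure_ge0 Q S); move: (fine (Q S)) => x x0.
rewrite -EFinM -EFinD lee_fin BE expRD !expRM lnK ?posrE//.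
rewrite mulrAC -powRM ?expR_ge0//.
set y := expR s * x; have y0 : 0 <= y by rewrite mulr_ge0// expR_ge0.
have yd0 : y + delta != 0 by rewrite gt_eqF// ltr_wpDl.
(* The bases [y] and [delta] are each at most [y + delta], and the exponents add up to 1. *)
have -> : y + delta = (y + delta) `^ theta * (y + delta) `^ (1 - theta).
  rewrite -powRD ?yd0 ?implybT// subrKC powRr1//.
  by rewrite addr_ge0// ltW.
apply: ler_pM; rewrite ?powR_ge0//; apply: ge0_ler_powR; rewrite ?nnegrE//.
- exact: ltW.
- by rewrite addr_ge0// ltW.
- by rewrite lerDl ltW.
- by rewrite subr_ge0 ltW.
- exact: ltW.
- by rewrite addr_ge0// ltW.
- by rewrite lerDr.
Qed.

End approximate_privacy.

Theorem corollary3p1 (R : realType) (X : Type) (sim : X -> X -> Prop)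
    (sim_sym : forall x x', sim x x' -> sim x' x)
    (dY : nat -> measure_display) (Y : forall i, measurableType (dY i))
    (k : nat) (k_ge1 : (1 <= k)%N)
    (eps : 'I_k -> R) (eps_gt0 : forall i, 0 < eps i)
    (delta_g : R) (delta_g01 : 0 <= delta_g <= 1) :
  AdaComp_DP sim (fun i : 'I_k => bounded_range sim (Y i) (eps i))
    (eps_g eps delta_g) delta_g.
Proof.
move=> dT T A b S mS; have /andP[d0 d1] := delta_g01.
set P := AdaComp A b; set Q := AdaComp A (~~ b).
(* This settles [delta_g = 0] and the case where the first entry is the minimum. *)
have pure : (P S <= (expR (\sum_(i < k) eps i))%:E * Q S + delta_g%:E)%E.
  have dom : power_dominated 1 (expR (\sum_(i < k) eps i)) P Q.
    apply: AdaComp_power_dominated => //; first by rewrite ltr01 lexx.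
    by move=> i M x x' brM xx'; exact: bounded_range_pure brM xx'.
  apply: (le_trans (power_dominated_set (oner_neq0 R) mS dom)).
  rewrite powRr1 ?fine_ge0// EFinM fineK ?fin_num_measure//.
  by rewrite leeDl// lee_fin.
rewrite /eps_g; case: ifPn => [//|dn0].
rewrite /Num.min; case: ifPn => // _.
(* At [delta_g = 1] the square root vanishes and with it the optimal [theta], but the bound is
   trivial. *)
have [->|dn1] := eqVneq delta_g 1.
  apply: (le_trans (probability_le1 P mS)).
  by rewrite leeDr// mule_ge0// lee_fin expR_ge0.
have delta01 : 0 < delta_g < 1 by rewrite !lt_neqAle eq_sym dn0 dn1 d0.
apply: power_dominated_approx => //.
  rewrite (bigD1 (Ordinal k_ge1))//= ltr_wpDr ?exprn_gt0//.
  by apply: sumr_ge0 => i _; rewrite sqr_ge0.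
move=> theta theta01.
rewrite mulr_suml !mulr_sumr -big_split/=.
apply: AdaComp_power_dominated => //.
  by case/andP: theta01 => -> /ltW.
move=> i M x x' brM xx'; rewrite -[_ - _]/(bounded_range_mean (eps i)).
exact: bounded_range_power_dominated brM xx'.
Qed.
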